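(* Every graph with minimum degree $\delta\geq 9$ has a $\frac{1}{3}$-majority $4$-edge-colouring.
   Context: Graphs are finite and simple. A $\frac{1}{k}$-majority $l$-edge-colouring of a graph $G$ is an assignment to each edge of $G$ of one of $l$ colours such that for every colour $i$ and every vertex $v$ of $G$, at most $\frac{d_G(v)}{k}$ of the edges incident with $v$ have colour $i$ (where $d_G(v)$ is the degree of $v$). *)

(* Defs.v *)
From mathcomp Require Import all_boot all_order all_algebra.

Set Implicit Arguments.
Unset Strict Implicit.
Unset Printing Implicit Defensive.

Import Order.TTheory GRing.Theory Num.Theory.

Record sgraph := SGraph {
  vertex :> finType;
  adj : rel vertex;
  adj_sym : symmetric adj;
  adj_irr : irreflexive adj }.

Definition edges (G : sgraph) : {set {set G}} :=
  [set [set p.1; p.2] | p : G * G & adj p.1 p.2].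

(* The type of edges of G, each edge being the set of its two end vertices. *)
Definition edge (G : sgraph) : finType := {A : {set G} | A \in edges G}.

Definition incident (G : sgraph) (v : G) : {set edge G} :=
  [set a : edge G | v \in sval a].

Definition deg (G : sgraph) (v : G) : nat := #|incident v|.

(* The bound d(v)/k is an exact quotient, hence taken in the rationals. *)
Definition majority_edge_colouring (k l : nat) (G : sgraph)
    (c : edge G -> 'I_l) : Prop :=
  forall (i : 'I_l) (v : G),
    (#|[set a in incident v | c a == i]|%:R <= (deg v)%:R / k%:R :> rat)%R.

(* Main.v *)
Require Import Defs.
From mathcomp Require Import all_boot all_order all_algebra.
From mathcomp Require Import perm zify.

Set Implicit Arguments.
Unset Strict Implicit.
Unset Printing Implicit Defensive.

(** The statement is an instance of the Hakimi-Kariv generalisation of Vizing's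
    theorem: if [deg u < l * f u] for every vertex [u] of a simple graph, then
    its edges have an [l]-colouring with at most [f u] edges of each colour at
    each [u].  Here [l = 4] and [f u = deg u %/ 3]; writing [deg u = 3q + r],
    the hypothesis reads [r < q], which [deg u >= 9] guarantees.

    As in Vizing's proof, a partial colouring is improved by rotating a fan of
    edges at an endpoint [v] of an uncoloured edge.  When the colour [c] lacking
    at the far end [w] of the fan repeats an earlier fan colour, the colours
    [c] and some [a] lacking at [v] are first exchanged along an alternating
    trail starting at [w].  The trail is built greedily: only its edge set, its
    current end and the parity are recorded, and the balance of the two colours
    at each vertex shows that it can be continued until it may stop. *)

(** Along a path the head is never a second argument; for fans, this leaves the colour of the first
    edge unconstrained. *)
Lemma sub_path_tail (T : eqType) (r r' : rel T) x s :
  {in x :: s & s, subrel r r'} -> path r x s -> path r' x s.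
Proof.
elim: s x => //= y s IH x rr' /andP[rxy rs]; apply/andP; split.
  by apply: rr'; rewrite ?mem_head.
apply: IH rs => z t zs ts; apply: rr'; by rewrite inE ?zs ?ts orbT.
Qed.

(** * Partial edge-colourings with bounded colour counts *)

Section FColouring.

Variables (V E : finType) (ends : E -> {set V}) (l : nat) (f : V -> nat).
Hypothesis ends_card : forall e, #|ends e| = 2.
Hypothesis ends_inj : injective ends.
Hypothesis deg_lt : forall u, \sum_e (u \in ends e) < l * f u.

Implicit Types (col : E -> option 'I_l) (e : E) (u v w x : V) (S : {set E}).

Definition colour_count col (i : 'I_l) u : nat :=
  \sum_e ((u \in ends e) && (col e == Some i)).

Definition f_valid col := forall i u, colour_count col i u <= f u.

Definition missing col i u := colour_count col i u < f u.

Definition uncoloured col : nat := \sum_e (col e == None).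

Definition other v e : V := odflt v [pick u in ends e :\ v].

Lemma otherP v e : v \in ends e ->
  other v e != v /\ ends e = [set v; other v e].
Proof.
move=> ve; have c1 : #|ends e :\ v| = 1.
  by move: (ends_card e); rewrite (cardsD1 v) ve add1n => -[].
rewrite /other; case: pickP => [u /= ue | none]; last first.
  by move: c1; rewrite (eq_card0 none).
have [uv _] : u != v /\ u \in ends e by move: ue; rewrite !inE => /andP.
split=> //; have /cards1P[z zE] : #|ends e :\ v| == 1 by rewrite c1.
by rewrite -(setD1K ve) zE; move: ue; rewrite zE inE => /eqP ->.
Qed.

Lemma mem_ends v e u : v \in ends e ->
  (u \in ends e) = (u == v) || (u == other v e).
Proof. by case/otherP=> _ ->; rewrite !inE. Qed.

Lemma other_inj v e e' : v \in ends e -> v \in ends e' ->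
  other v e = other v e' -> e = e'.
Proof.
move=> /otherP[_ ee] /otherP[_ ee'] eq_o; apply: ends_inj.
by rewrite ee ee' eq_o.
Qed.

(** Pigeonhole: if every colour were full at [u], the colour counts would sum to at least [l * f u],
    yet each edge at [u] contributes to at most one of them. *)
Lemma exists_missing col u : exists i, missing col i u.
Proof.
apply/existsP; rewrite -[[exists _, _]]negbK negb_exists; apply/negP => /forallP full.
have: l * f u <= \sum_(i < l) colour_count col i u.
  rewrite -[X in X * _]card_ord -sum_nat_const; apply: leq_sum => i _.
  by rewrite leqNgt full.
rewrite leqNgt => /negP; apply; apply: leq_ltn_trans (deg_lt u).
rewrite exchange_big /=; apply: leq_sum => e _.
case: (u \in ends e) => /=; last by rewrite big1.
case: (col e) => [j|]; last by rewrite big1.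
rewrite (bigD1 j) //= eqxx big1 // => i ij.
by apply/eqP; rewrite eqb0; apply: contra ij => /eqP[->].
Qed.

Lemma f_gt0 u : 0 < f u.
Proof. by move: (deg_lt u); case: (f u) => //; rewrite muln0. Qed.

(** Writing the contribution of one edge as a sum over all edges lets the balance equations below be
    checked term by term. *)
Lemma sum_pred1 e (P : pred E) : \sum_e' (P e' && (e' == e)) = P e.
Proof.
rewrite (bigD1 e) //= eqxx andbT big1 ?addn0 // => e' /negbTE ->.
by rewrite andbF.
Qed.

Definition recolour col e y := fun e' => if e' == e then y else col e'.

(** Gains and losses stand on opposite sides, which avoids truncated subtraction. *)
Lemma colour_count_recolour col e y i u :
  colour_count (recolour col e y) i u + ((u \in ends e) && (col e == Some i)) =
  colour_count col i u + ((u \in ends e) && (y == Some i)).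
Proof.
rewrite -(sum_pred1 e (fun e => (u \in ends e) && (col e == Some i))).
rewrite -(sum_pred1 e (fun e => (u \in ends e) && (y == Some i))).
rewrite /colour_count -!big_split /=; apply: eq_bigr => e' _.
rewrite /recolour; have [->|_] := eqVneq e' e; last by rewrite !andbF.
by rewrite !andbT addnC.
Qed.

Lemma uncoloured_recolour col e y :
  uncoloured (recolour col e y) + (col e == None) = uncoloured col + (y == None).
Proof.
rewrite -(sum_pred1 e (fun e => col e == None)) -(sum_pred1 e (fun=> y == None)).
rewrite /uncoloured -!big_split /=; apply: eq_bigr => e' _.
rewrite /recolour; have [->|_] := eqVneq e' e; last by rewrite !andbF.
by rewrite !andbT addnC.
Qed.

(** * Fans and their rotation *)

Definition fan_step col v e e' :=
  if col e' is Some i then missing col i (other v e) else false.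

Lemma fan_path_transfer col col' v e0 es : {in es, col' =1 col} ->
  (forall e e' i, e \in e0 :: es -> e' \in es -> col e' = Some i ->
     missing col i (other v e) -> missing col' i (other v e)) ->
  path (fan_step col v) e0 es -> path (fan_step col' v) e0 es.
Proof.
move=> colE miss; apply: sub_path_tail => e e' he he'.
rewrite /fan_step colE //; case colE': (col e') => [i|] //; exact: miss colE'.
Qed.

(** Induction along the fan: [e0] takes the colour of [e1], which becomes the uncoloured head of a
    shorter fan. Counts at [v] do not change, since both edges contain [v]. The last edge finally
    receives [i], which has room at both its ends. *)
Lemma fan_rotation v i es : forall col e0, f_valid col -> col e0 = None ->
  all (fun e => v \in ends e) (e0 :: es) -> path (fan_step col v) e0 es ->
  uniq (map col (e0 :: es)) ->
  missing col i v -> missing col i (other v (last e0 es)) ->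
  exists2 col', f_valid col' & uncoloured col' < uncoloured col.
Proof.
elim: es => [|e1 es IH] col e0 vcol col0.
  move=> /= /andP[ve0 _] _ _ iv iw; exists (recolour col e0 (Some i)).
    move=> k u; have := colour_count_recolour col e0 (Some i) k u.
    have := vcol k u; rewrite col0 andbF (mem_ends _ ve0) (inj_eq (@Some_inj _)).
    have [<- /=|ki] := eqVneq i k; last by rewrite andbF; clear; lia.
    case: eqP => [->|_] /=; first by move: iv; rewrite /missing; clear; lia.
    case: eqP => [->|_] /=; first by move: iw; rewrite /missing; clear; lia.
    by clear; lia.
  by have := uncoloured_recolour col e0 (Some i); rewrite col0 /=; clear; lia.
rewrite [all _ _]/= [path _ _ _]/= [map _ _]/= [last _ _]/=.
move=> /and3P[ve0 ve1 ves] /andP[step pes] /= /andP[None_nin /andP[c1_nin ues]] iv iw.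
move: step None_nin c1_nin; rewrite {1}/fan_step col0.
case c1E: (col e1) => [a|] // aw; rewrite inE /= => None_nin c1_nin.
have e10 : e1 != e0 by apply/eqP => e10; rewrite e10 col0 in c1E.
have es0 e : e \in es -> e != e0.
  by move=> ees; apply: contraNneq None_nin => ee0; rewrite -col0 -ee0 map_f.
have es1 e : e \in es -> e != e1.
  by move=> ees; apply: contraNneq c1_nin => ee1; rewrite -c1E -ee1 map_f.
have recE : recolour col e0 (Some a) e1 = Some a.
  by rewrite /recolour (negbTE e10).
pose col1 := recolour (recolour col e0 (Some a)) e1 None.
have cnt k u : colour_count col1 k u + ((u \in ends e1) && (a == k)) =
               colour_count col k u + ((u \in ends e0) && (a == k)).
  have := colour_count_recolour (recolour col e0 (Some a)) e1 None k u.
  have := colour_count_recolour col e0 (Some a) k u.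
  rewrite -/col1 recE col0 !andbF !(inj_eq (@Some_inj _)).
  by clear; lia.
have cntv k : colour_count col1 k v = colour_count col k v.
  by have := cnt k v; rewrite ve0 ve1; clear; lia.
(* Apart from [v], only the far end of [e0] gains a colour, and since [ends] is injective no later
   fan edge has that far end. *)
have cntle e k : e \in e1 :: es ->
    colour_count col1 k (other v e) <= colour_count col k (other v e).
  move=> ees; have ve : v \in ends e by move: ees; rewrite inE => /orP[/eqP->|/(allP ves)].
  have := cnt k (other v e); rewrite (mem_ends _ ve0).
  have [ov _] := otherP ve; rewrite (negbTE ov) /=.
  case: (eqVneq (other v e) (other v e0)) => [oo|_] /=; last by clear; lia.
  by move: ees; rewrite (other_inj ve ve0 oo) inE eq_sym (negbTE e10) /= => /es0; rewrite eqxx.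
have colE : {in es, col1 =1 col}.
  by move=> e ees; rewrite /col1 /recolour (negbTE (es0 _ ees)) (negbTE (es1 _ ees)).
have col1e1 : col1 e1 = None by rewrite /col1 /recolour eqxx.
have unc : uncoloured col1 = uncoloured col.
  have := uncoloured_recolour (recolour col e0 (Some a)) e1 None.
  have := uncoloured_recolour col e0 (Some a).
  by rewrite -/col1 recE col0 /=; clear; lia.
rewrite -unc; apply: (IH col1 e1) => //.
- move=> k u; have := cnt k u; have := vcol k u; rewrite (mem_ends _ ve0).
  have [<-|_] := eqVneq a k; last by rewrite !andbF; clear; lia.
  case: (eqVneq u v) => [->|_] /=; first by rewrite ve1; clear; lia.
  case: (eqVneq u (other v e0)) => [->|_] /=; last by clear; lia.
  by move: aw; rewrite /missing; clear; lia.
- by rewrite /= ve1.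
- apply: fan_path_transfer pes => // e e' k ees _ _.
  by apply: leq_ltn_trans; apply: cntle.
- have -> : map col1 (e1 :: es) = None :: map col es.
    by rewrite /= col1e1; congr cons; apply/eq_in_map.
  by rewrite /= None_nin.
- by rewrite /missing cntv.
by apply: leq_ltn_trans iw; apply: cntle; apply: mem_last.
Qed.

(** * Alternating trails in two colours *)

Definition count_in S col (i : 'I_l) u : nat :=
  \sum_e ((u \in ends e) && (col e == Some i) && (e \in S)).

Lemma count_inU1 S col i u e : e \notin S ->
  count_in (e |: S) col i u =
  count_in S col i u + ((u \in ends e) && (col e == Some i)).
Proof.
move=> eS; rewrite -(sum_pred1 e (fun e => (u \in ends e) && (col e == Some i))).
rewrite /count_in -big_split /=; apply: eq_bigr => e' _; rewrite in_setU1.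
have [->|_] := eqVneq e' e; last by rewrite andbF addn0.
by rewrite (negbTE eS) andbF !andbT.
Qed.

Lemma count_in_le S col i u : count_in S col i u <= colour_count col i u.
Proof. by apply: leq_sum => e _; case: (e \in S); rewrite ?andbT ?andbF. Qed.

Lemma count_in_lt S col i u : count_in S col i u < colour_count col i u ->
  exists e, [/\ e \notin S, u \in ends e & col e = Some i].
Proof.
move=> lt; have [e /and3P[eS ue /eqP ce] | none] :=
  pickP [pred e | [&& e \notin S, u \in ends e & col e == Some i]].
  by exists e.
move: lt; rewrite ltnNge => /negP[]; apply: leq_sum => e _.
by have /= := none e; case: (e \in S); case: (_ \in _); case: (_ == _).
Qed.

Lemma count_in0 col i u : count_in set0 col i u = 0.
Proof. by rewrite /count_in big1 // => e _; rewrite in_set0 andbF. Qed.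

Section AlternatingTrail.

Variables (col : E -> option 'I_l) (a c : 'I_l) (v w : V) (e1 : E).
Hypotheses (vcol : f_valid col) (ac : a != c) (vw : v != w).
Hypotheses (cw : missing col c w) (av : missing col a v).
Hypotheses (cv : ~~ missing col c v) (ve1 : v \in ends e1) (ce1 : col e1 = Some c).

(* [S] is the edge set of a trail from [w] to [x] whose edges are alternately
   coloured [a] and [c], starting with [a]; [s] says that the last one is
   coloured [a].  The empty trail has [x = w] and [s = false]. *)
Definition trail_balance S x (s : bool) := forall u,
  count_in S col a u + (~~ s && (u == x)) =
  count_in S col c u + (u == w) + (s && (u == x)).

(* The colours may be exchanged on the trail without overloading its end; when
   the trail closes up at [w], the colour [c] has already been gained there. *)
Definition trail_stop x (s : bool) :=
  if s then colour_count col c x + (x == w) < f x else missing col a x.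

(** If the trail has used up the next colour at [x], the balance contradicts either [trail_stop]
    failing or the bound [f x] on the other colour. The last clause ensures that [e1] can only be
    traversed towards [v]. *)
Lemma trail_step S x s : e1 \notin S -> trail_balance S x s -> ~~ trail_stop x s ->
  exists e, [/\ e \notin S, x \in ends e, col e = Some (if s then c else a)
              & x = v -> e != e1].
Proof.
move=> e1S bal; move: (bal x) (count_in_le S col a x) (count_in_le S col c x).
move: (vcol a x) (vcol c x) av cw cv {bal}.
rewrite eqxx !andbT /trail_stop /missing => va vc av' cw' cv' bal Aa Cc.
case: s bal => /= bal nstop.
  have [xv|xv] := eqVneq x v.
    have : count_in (e1 |: S) col c x < colour_count col c x.
      rewrite count_inU1 // xv ve1 ce1 eqxx /=; subst x.
      move: bal Aa av' cv'; rewrite (negbTE vw); clear; lia.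
    case/count_in_lt=> e []; rewrite in_setU1 negb_or => /andP[ee1 eS] xe ce.
    by exists e.
  have /count_in_lt[e [eS xe ce]] : count_in S col c x < colour_count col c x.
    move: bal va Aa nstop; clear; lia.
  by exists e; split=> // xv'; rewrite xv' eqxx in xv.
have /count_in_lt[e [eS xe ce]] : count_in S col a x < colour_count col a x.
  move: bal vc Cc nstop; have [xw|_] := eqVneq x w; last by clear; lia.
  by subst x; move: cw'; clear; lia.
exists e; split=> // xv; apply: contraTneq ac => ee1.
by move: ce; rewrite ee1 ce1 => -[->]; rewrite eqxx.
Qed.

Lemma trail_balance_step S x s e : e \notin S -> x \in ends e ->
  col e = Some (if s then c else a) -> trail_balance S x s ->
  trail_balance (e |: S) (other x e) (~~ s).
Proof.
move=> eS xe ce bal u; have := bal u; have [ox _] := otherP xe.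
rewrite !count_inU1 // ce !(inj_eq (@Some_inj _)) (mem_ends _ xe).
have ca : c == a = false by rewrite eq_sym; apply: negbTE.
case: s {ce bal} => /=; rewrite ?eqxx ?(negbTE ac) ?ca ?andbF ?andbT /=.
  have [->|] := eqVneq u x; last by clear; lia.
  by rewrite [x == other _ _]eq_sym (negbTE ox); clear; lia.
have [->|] := eqVneq u x; last by clear; lia.
by rewrite [x == other _ _]eq_sym (negbTE ox); clear; lia.
Qed.

(** Extend the trail until it may stop or has just taken [e1]. In the latter case it has reached [v]
    by colour [c], and it may stop there because [a] is missing at [v]. *)
Lemma exists_trail : exists S x s,
  [/\ trail_balance S x s, trail_stop x s
    & e1 \notin S \/ x = v /\ s = false].
Proof.
suff ext n S x s : #|~: S| <= n -> e1 \notin S -> trail_balance S x s ->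
    exists S x s, [/\ trail_balance S x s, trail_stop x s
                    & e1 \notin S \/ x = v /\ s = false].
  apply: (ext _ set0 w false (leqnn _)); first by rewrite in_set0.
  by move=> u; rewrite !count_in0 addn0.
elim: n S x s => [|n IH] S x s.
  rewrite leqn0 cards_eq0 => /eqP S0 e1S.
  by have := in_set0 e1; rewrite -S0 in_setC e1S.
move=> Sn e1S bal; have [stop|nstop] := boolP (trail_stop x s).
  by exists S, x, s; split=> //; left.
have [e [eS xe ce xv]] := trail_step e1S bal nstop.
have bal' := trail_balance_step eS xe ce bal.
have [ee1|ee1] := eqVneq e e1; last first.
  apply: IH bal'; last by rewrite in_setU1 negb_or eq_sym ee1.
  have : ~: (e |: S) = (~: S) :\ e by apply/setP => z; rewrite !inE negb_or.
  by move->; move: Sn; rewrite (cardsD1 e) in_setC eS.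
have ov : other x e = v.
  have : v \in ends e by rewrite ee1.
  rewrite (mem_ends _ xe) => /orP[/eqP vx|/eqP->] //.
  by have := xv (esym vx); rewrite ee1 eqxx.
have st : s = true.
  move: ce ac; rewrite ee1 ce1; case: s {bal nstop bal'} => // -[->].
  by rewrite eqxx.
exists (e |: S), v, false; split; [|exact: av|by right].
by rewrite -ov; move: bal'; rewrite st.
Qed.

(** * Exchanging the two colours on a trail *)

Definition swap S e := if e \in S then omap (tperm a c) (col e) else col e.

Lemma colour_count_swap S i u :
  colour_count (swap S) i u + count_in S col i u =
  colour_count col i u + count_in S col (tperm a c i) u.
Proof.
rewrite /colour_count /count_in -!big_split /=; apply: eq_bigr => e _.
rewrite /swap; case: (e \in S); last by rewrite !andbF.
rewrite !andbT addnC; congr (_ + nat_of_bool (_ && _)).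
case: (col e) => [k|] //=; rewrite !(inj_eq (@Some_inj _)).
by rewrite (can2_eq (tpermK a c) (tpermK a c)).
Qed.

Lemma uncoloured_swap S : uncoloured (swap S) = uncoloured col.
Proof.
by apply: eq_bigr => e _; rewrite /swap; case: (_ \in S) => //; case: (col e).
Qed.

Lemma swap_id S e : e \notin S \/ col e != Some a /\ col e != Some c ->
  swap S e = col e.
Proof.
rewrite /swap => -[/negbTE->//|[]]; case: ifP => // _; case: (col e) => // k.
by rewrite !(inj_eq (@Some_inj _)) /= => ka kc; rewrite tpermD // eq_sym.
Qed.

Lemma colour_count_swap_id S i u : i != a -> i != c ->
  colour_count (swap S) i u = colour_count col i u.
Proof.
move=> ia ic; have := colour_count_swap S i u.
by rewrite tpermD 1?eq_sym // => /addIn.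
Qed.

(** At vertices other than the ends [w] and [x], the trail uses both colours equally, so the
    exchange changes counts at its ends only. *)
Lemma colour_count_swap_trail S x s u : trail_balance S x s ->
  (colour_count (swap S) a u + (u == w) + (s && (u == x)) =
     colour_count col a u + (~~ s && (u == x))) /\
  (colour_count (swap S) c u + (~~ s && (u == x)) =
     colour_count col c u + (u == w) + (s && (u == x))).
Proof.
move=> bal; have := bal u.
have := colour_count_swap S a u; have := colour_count_swap S c u.
by rewrite tpermL tpermR; clear; lia.
Qed.

Lemma swap_valid S x s : trail_balance S x s -> trail_stop x s ->
  f_valid (swap S).
Proof.
move=> bal stop i u; have [ca cc] := colour_count_swap_trail u bal.
move: ca cc (vcol a u) (vcol c u) (vcol i u) cw stop {bal}.
rewrite /trail_stop /missing; have [->|ia] := eqVneq i a.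
  case: s => /=; first by clear; lia.
  by have [->|] := eqVneq u x; clear; lia.
have [->|ic] := eqVneq i c; last first.
  by move=> _ _ _ _ +; rewrite colour_count_swap_id.
case: s => /=.
  have [->|_] := eqVneq u x; last by have [->|_] := eqVneq u w; clear; lia.
  by have [->|_] := eqVneq x w; clear; lia.
by have [->|] := eqVneq u w; clear; lia.
Qed.

End AlternatingTrail.

(** * Colouring one more edge *)

Lemma improve_colouring col e0 : f_valid col -> col e0 = None ->
  exists2 col', f_valid col' & uncoloured col' < uncoloured col.
Proof.
move=> vcol col0.
have [v ve0] : exists v, v \in ends e0.
  by apply/set0Pn; rewrite -card_gt0 ends_card.
have [a av] := exists_missing col v.
(* The fan grows while its colours stay distinct and differ from [a]. With [None] for [e0], only
   [l.+1] values are available, which bounds its length. *)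
suff ext n es : l.+1 - size es <= n -> all (fun e => v \in ends e) (e0 :: es) ->
    path (fan_step col v) e0 es -> uniq (Some a :: map col (e0 :: es)) ->
    exists2 col', f_valid col' & uncoloured col' < uncoloured col.
  by apply: (ext _ [::] (leqnn _)); rewrite /= ?ve0 ?col0.
elim: n es => [|n IH] es sz ves pes ues.
  have := max_card (mem (Some a :: map col (e0 :: es))).
  by rewrite (card_uniqP ues) card_option card_ord /= size_map; move: sz; clear; lia.
have [c cw] := exists_missing col (other v (last e0 es)).
have [cv|ncv] := boolP (missing col c v).
  by apply: (fan_rotation (i := c) vcol col0 ves pes) => //; case/andP: ues.
have ac : a != c by apply: contraNneq ncv => <-.
(* Since [c] is full at [v] and [f v] is positive, some edge at [v] has colour [c]; if [c] is new to
   the fan, that edge extends it. *)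
have [ces|nces] := boolP (Some c \in map col es); last first.
  have : count_in set0 col c v < colour_count col c v.
    by rewrite count_in0; move: ncv (f_gt0 v); rewrite /missing; clear; lia.
  case/count_in_lt=> e [_ ve ce]; apply: (IH (rcons es e)).
  - by rewrite size_rcons; move: sz; clear; lia.
  - by rewrite -rcons_cons all_rcons ve.
  - by rewrite rcons_path pes /fan_step ce.
  rewrite -rcons_cons map_rcons -rcons_cons rcons_uniq ues andbT ce.
  rewrite map_cons col0 !inE negb_or nces andbT.
  by rewrite (inj_eq (@Some_inj _)) eq_sym.
have {ces} [e1 e1es ce1] := mapP ces.
have [p1 [p2 esE]] : exists p1 p2, es = p1 ++ e1 :: p2.
  by case/splitPr: e1es => p1 p2; exists p1, p2.
set w := other v (last e0 es) in cw; set wj := other v (last e0 p1).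
have lastE : last e0 es = last e1 p2 by rewrite esE last_cat.
have memv e : e \in e0 :: es -> v \in ends e by move/(allP ves).
have vk : v \in ends (last e0 es) by apply/memv/mem_last.
have vj : v \in ends (last e0 p1).
  by apply: memv; rewrite esE -cat_cons mem_cat mem_last.
have [wv _] := otherP vk; have [wjv _] := otherP vj.
have vw : v != w by rewrite eq_sym.
have ves1 : all (fun e => v \in ends e) (e0 :: p1).
  by apply/allP => e he; apply: memv; rewrite esE -cat_cons mem_cat he.
have ve1 : v \in ends e1 by apply: memv; rewrite inE e1es orbT.
move: (ues); rewrite cons_uniq => /andP[anin]; rewrite esE -cat_cons map_cat cat_uniq => /and3P[ucol1 disj].
rewrite [map _ (e1 :: _)]/= -ce1 => /andP[cnin2 ucol2].
have wjw : wj != w.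
  apply: contra disj => /eqP /(other_inj vj vk) jk; apply/hasP.
  exists (col (last e0 es)); first by rewrite lastE map_f ?mem_last.
  by rewrite -jk map_f ?mem_last.
have cnin1 : Some c \notin map col (e0 :: p1).
  by apply: contra disj => cin; apply/hasP; exists (Some c) => //; rewrite ce1 mem_head.
(* Hence [e1] is the only fan edge whose colour the exchange can alter. *)
have colD e : e \in p1 ++ p2 -> col e != Some a /\ col e != Some c.
  rewrite mem_cat => ep; split; [apply: contraNneq anin => ea|].
    rewrite -ea map_f // inE esE mem_cat inE.
    by case/orP: ep => ->; rewrite ?orbT.
  case/orP: ep => ep; [apply: contraNneq cnin1|apply: contraNneq cnin2] => <-.
    by rewrite map_f // inE ep orbT.
  by rewrite map_f.
have [S [x [s [bal stop e1S]]]] :=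
  exists_trail vcol ac vw cw av ncv ve1 (esym ce1).
have vsw := swap_valid vcol cw bal stop.
have unc := uncoloured_swap col a c S.
set col' := swap col a c S in vsw unc.
have colE e : e \in p1 ++ p2 -> col' e = col e.
  by move=> /colD ?; apply: swap_id; right.
have col'0 : col' e0 = None by rewrite /col' /swap col0; case: ifP.
have missE e e' i : e' \in p1 ++ p2 -> col e' = Some i ->
    missing col i (other v e) -> missing col' i (other v e).
  move=> /colD[] + + ce'; rewrite ce' !(inj_eq (@Some_inj _)) => ia ic.
  by rewrite /missing colour_count_swap_id.
move: (pes); rewrite esE cat_path => /andP[pes1 /andP[stepj pes2]].
have pes1' : path (fan_step col' v) e0 p1.
  apply: fan_path_transfer pes1 => [e ep|e e' i _ ep]; first by apply: colE; rewrite mem_cat ep.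
  by apply: missE; rewrite mem_cat ep.
have pes2' : path (fan_step col' v) e1 p2.
  apply: fan_path_transfer pes2 => [e ep|e e' i _ ep].
    by apply: colE; rewrite mem_cat ep orbT.
  by apply: missE; rewrite mem_cat ep orbT.
have ucol1' : uniq (map col' (e0 :: p1)).
  have -> // : map col' (e0 :: p1) = map col (e0 :: p1).
  apply/eq_in_map => e; rewrite inE => /orP[/eqP->|ep]; first by rewrite col'0.
  by apply: colE; rewrite mem_cat ep.
have cwj : missing col c wj by move: stepj; rewrite /fan_step -ce1.
have [ca_v cc_v] := colour_count_swap_trail v bal.
have [ca_w cc_w] := colour_count_swap_trail w bal.
have [ca_j cc_j] := colour_count_swap_trail wj bal.
rewrite -/col' in ca_v cc_v ca_w cc_w ca_j cc_j.
(* If the trail ends at [v], it does so by colour [c], which the exchange then frees at [v]. As [c]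
   is still missing at [wj], the fan up to [p1] is rotated with [c]. *)
rewrite -unc; have [xv|xv] := eqVneq x v.
  have s0 : s = false.
    apply: contraNF ncv => st; move: stop; rewrite /trail_stop st xv /missing.
    by apply: leq_ltn_trans; apply: leq_addr.
  have cj' : missing col' c wj.
    move: cc_j cwj; rewrite s0 xv (negbTE wjw) (negbTE wjv) /missing /=; clear; lia.
  apply: (fan_rotation (i := c) vsw col'0 ves1 pes1' ucol1') => //.
  move: cc_v (vcol c v); rewrite s0 xv (negbTE vw) eqxx /missing /=; clear; lia.
have av' : missing col' a v.
  move: ca_v av; rewrite [v == x]eq_sym (negbTE xv) (negbTE vw) !andbF /missing.
  by clear; lia.
(* If the trail ends at [wj] by colour [a], the exchange frees [a] there, and the fan up to [p1] is
   rotated with [a]. *)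
have [/andP[/eqP xj st]|xj] := boolP ((x == wj) && s).
  apply: (fan_rotation (i := a) vsw col'0 ves1 pes1' ucol1') => //.
  move: ca_j (vcol a wj); rewrite st xj eqxx /missing -/wj /=; clear; lia.
(* Otherwise [e1] keeps its colour [c], which is still missing at [wj]; the whole fan survives and
   is rotated with [a]. *)
have {}e1S : e1 \notin S by case: e1S => // -[xv']; rewrite xv' eqxx in xv.
have colE1 : col' e1 = col e1 by apply: swap_id; left.
have colEs : {in es, col' =1 col}.
  move=> e; rewrite esE mem_cat inE => ep; have [->//|ee1] := eqVneq e e1.
  by apply: colE; rewrite mem_cat; move: ep; rewrite (negbTE ee1).
apply: (fan_rotation (i := a) (es := es) vsw col'0 ves) => //.
- rewrite esE cat_path pes1' /= pes2' andbT /fan_step colE1 -ce1 -/wj.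
  move: cc_j cwj xj; rewrite (negbTE wjw) eq_sym /missing.
  by clear; case: s; case: eqP => /=; lia.
- have -> : map col' (e0 :: es) = map col (e0 :: es); last by case/andP: ues.
  by apply/eq_in_map => e; rewrite inE => /orP[/eqP->|/colEs//]; rewrite col'0.
(* The exchange frees [a] at [w], unless the trail ends at [w] with [s = false]; then the count is
   unchanged, but [trail_stop] says that [a] was already missing. *)
move: ca_w (vcol a w) stop; rewrite eqxx /trail_stop /missing -/w.
by have [<-|_] := eqVneq w x; case: s {bal xj ca_v cc_v cc_w ca_j cc_j} => /=; clear; lia.
Qed.

Theorem f_colouring : exists c : E -> 'I_l,
  forall i u, \sum_e ((u \in ends e) && (c e == i)) <= f u.
Proof.
suff ext n col : uncoloured col <= n -> f_valid col ->
    exists2 col', f_valid col' & uncoloured col' = 0.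
  have [|col vcol /eqP] := ext _ (fun=> None) (leqnn _).
    by move=> i u; rewrite /colour_count big1 // => e _; rewrite andbF.
  rewrite sum_nat_eq0 => /forallP tot.
  have {}tot e : col e by have := tot e; case: (col e).
  (* The type ['I_l] may be empty, so there is no default colour; totality excludes [None]
     instead. *)
  pose c e := match col e as o return o -> 'I_l with
              | Some i => fun=> i
              | None => fun h => match notF h with end
              end (tot e).
  have cE e : col e = Some (c e).
    by rewrite /c; move: (tot e); case: (col e).
  exists c => i u; apply: leq_trans (vcol i u); apply: leq_sum => e _.
  by rewrite cE (inj_eq (@Some_inj _)).
elim: n col => [|n IH] col un vcol; first by exists col => //; lia.
have [e /eqP e0|tot] := pickP (fun e => col e == None).
  have [col' vcol' lt] := improve_colouring vcol e0.
  by apply: IH vcol'; move: lt un; clear; lia.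
by exists col => //; rewrite /uncoloured big1 // => e _; rewrite tot.
Qed.

End FColouring.

(** * Application to majority colourings *)

Lemma edge_card (G : sgraph) (a : edge G) : #|sval a| = 2.
Proof.
case: a => A /= /imsetP[[x y] /=]; rewrite inE /= => xy ->.
by rewrite cards2; case: eqP xy => // ->; rewrite adj_irr.
Qed.

Theorem theorem15 (G : sgraph) (hdelta : forall v : G, 9 <= deg v) :
  exists c : edge G -> 'I_4, majority_edge_colouring 3 c.
Proof.
have degE (v : G) : \sum_(a : edge G) (v \in sval a) = deg v.
  by rewrite /deg -sum1_card [RHS]big_mkcond /=; apply: eq_bigr => a _; rewrite inE; case: ifP.
have deg_lt (v : G) : \sum_(a : edge G) (v \in sval a) < 4 * (deg v %/ 3).
  by rewrite degE; move: (hdelta v); clear; lia.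
have [c hc] := f_colouring (@edge_card G) val_inj deg_lt.
exists c => i v; rewrite Num.Theory.ler_pdivlMr // -GRing.natrM Num.Theory.ler_nat.
apply: leq_trans (leq_divM (deg v) 3); rewrite leq_mul2r /=.
apply: leq_trans (hc i v); rewrite -sum1_card big_mkcond /=.
by apply: leq_sum => a _; rewrite !inE; case: (_ && _).
Qed.
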